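(* Let $p$ be a prime number with $p\equiv 1 \pmod{24}$ and $\left(\frac{2}{p}\right)_4=1$, and let $E_p$ be the elliptic curve over $\mathbb{Q}$ given by $Y^2=(X-p)^3+X^3+(X+p)^3$. If there are integers $a,b,c,d$ such that $p=a^4+18b^4$ and $3p=c^4+2d^4$, then $\operatorname{rank}(E_p(\mathbb{Q}))\geq 2$.
   Context: $\operatorname{rank}(E_p(\mathbb{Q}))$ denotes the rank of the finitely generated abelian group $E_p(\mathbb{Q})$ (the Mordell-Weil group). For a prime $p\equiv 1\pmod 8$ (so that $2$ is a square mod $p$), $\left(\frac{2}{p}\right)_4$ denotes the rational quartic residue symbol: it equals $1$ if $2$ is a fourth power modulo $p$ and $-1$ otherwise. The change of variables $x=3X$, $y=3Y$ brings $E_p$ to the form $y^2=x^3+18p^2x$. *)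

(* Defs.v *)
From HB Require Import structures.
From mathcomp Require Import all_boot all_order all_algebra.
From mathcomp Require Import separable ring boolp classical_sets constructive_ereal ereal.

Set Implicit Arguments.
Unset Strict Implicit.
Unset Printing Implicit Defensive.
Import Order.TTheory GRing.Theory Num.Theory.
Local Open Scope ring_scope.

(* The elliptic curve y^2 = g(x), g a separable cubic, over a field of
   characteristic other than 2.  The leading coefficient of g need not be 1;
   the projective closure still has a single point at infinity, [0 : 1 : 0],
   which is a flex, so that with this point as origin three points of the
   curve sum to zero exactly when they are collinear. *)
Record ellCurve (F : fieldType) := EllCurve {
  cubic : {poly F};
  size_cubic : size cubic = 4;
  cubic_separable : separable_poly cubic;
  char_neq2 : 2%:R != 0 :> F
}.

Section Points.
Variables (F : fieldType) (E : ellCurve F).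
Local Notation g := (cubic E).

(* None is the point at infinity. *)
Definition on_curve (P : option (F * F)) : bool :=
  if P is Some (x, y) then y ^+ 2 == g.[x] else true.

Record ec_point := Point { coords :> option (F * F); _ : on_curve coords }.
HB.instance Definition _ := [isSub for coords].
HB.instance Definition _ := [Choice of ec_point by <:].

Definition ec_slope (x1 y1 x2 y2 : F) : F :=
  if x1 == x2 then g^`().[x1] / (2%:R * y1) else (y2 - y1) / (x2 - x1).

Definition opp_coords (P : option (F * F)) : option (F * F) :=
  if P is Some (x, y) then Some (x, - y) else None.

(* The chord-tangent law.  The abscissas of the points of the curve on a line of
   slope l are the roots of g - (l * 'X + m)^2, so their sum is
   (l^2 - g`_2) / g`_3. *)
Definition add_coords (P Q : option (F * F)) : option (F * F) :=
  match P, Q with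
  | None, _ => Q
  | _, None => P
  | Some (x1, y1), Some (x2, y2) =>
      if (x1 == x2) && (y1 == - y2) then None else
      let l := ec_slope x1 y1 x2 y2 in
      let x3 := (l ^+ 2 - g`_2) / g`_3 - x1 - x2 in
      Some (x3, - (y1 + l * (x3 - x1)))
  end.

Lemma opp_on_curve P : on_curve P -> on_curve (opp_coords P).
Proof. by case: P => [[x y]|] //=; rewrite sqrrN. Qed.

Lemma cubicE : g = g`_3 *: 'X^3 + g`_2 *: 'X^2 + g`_1 *: 'X + g`_0 *: 1.
Proof.
apply/polyP => i; rewrite !(coefE, coefZ, coefD, coefXn, coefX, coef1).
case: i => [|[|[|[|i]]]] /=; rewrite ?mulr1n ?mulr0n ?mulr0 ?mulr1 ?add0r ?addr0 //.
by rewrite nth_default // size_cubic.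
Qed.

Lemma lead_neq0 : g`_3 != 0.
Proof.
have := lead_coef_eq0 g; rewrite lead_coefE size_cubic /= => ->.
by rewrite -size_poly_eq0 size_cubic.
Qed.

Lemma hornerG x : g.[x] = g`_3 * x ^+ 3 + g`_2 * x ^+ 2 + g`_1 * x + g`_0.
Proof. by rewrite {1}cubicE !hornerE. Qed.

Lemma horner_derivG x :
  g^`().[x] = 3%:R * g`_3 * x ^+ 2 + 2%:R * g`_2 * x + g`_1.
Proof.
rewrite {1}cubicE !derivD !derivZ !derivXn derivX -(expr0 'X) derivXn.
rewrite !hornerE /=; ring.
Qed.

Lemma cubic_smooth x y : y ^+ 2 = g.[x] -> y = 0 -> g^`().[x] != 0.
Proof.
move=> exy y0; have := cubic_separable E; rewrite unlock => cop.
apply: (coprimep_root cop); by rewrite /root -exy y0 expr0n.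
Qed.

(* The morphism f and the element X of K allow the factorization to be used both
   for values in F and in the coordinate ring below. *)
Lemma lineP x1 y1 x2 y2 : y1 ^+ 2 = g.[x1] -> y2 ^+ 2 = g.[x2] ->
  ~~ ((x1 == x2) && (y1 == - y2)) ->
  let l := ec_slope x1 y1 x2 y2 in
  let x3 := (l ^+ 2 - g`_2) / g`_3 - x1 - x2 in
  [/\ y2 = y1 + l * (x2 - x1), x1 = x2 -> y1 != 0 &
   forall K : comNzRingType, forall f : {rmorphism F -> K}, forall X : K,
    f g`_3 * X ^+ 3 + f g`_2 * X ^+ 2 + f g`_1 * X + f g`_0
      - (f y1 + f l * (X - f x1)) ^+ 2
    = f g`_3 * (X - f x1) * (X - f x2) * (X - f x3)].
Proof.
move=> e1 e2 nopp l x3.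
have c0 := lead_neq0; have ch2 := char_neq2 E.
have y12 : x1 = x2 -> y2 = y1 /\ y1 != 0.
  move=> ex; have : (y1 - y2) * (y1 + y2) = 0.
    by rewrite -subr_sqr e1 e2 ex subrr.
  move: nopp; rewrite ex eqxx /= -addr_eq0 => nz /eqP.
  rewrite mulf_eq0 (negPf nz) orbF subr_eq0 => /eqP ey; split => //.
  by move: nz; rewrite ey -mulr2n -mulr_natl mulf_eq0 negb_or => /andP[].
have ey2 : y2 = y1 + l * (x2 - x1).
  rewrite /l /ec_slope; case: eqVneq => [ex|nex].
    by case: (y12 ex) => -> _; rewrite ex subrr mulr0 addr0.
  by field; rewrite subr_eq0 eq_sym.
split => //; first by move=> /y12[].
move=> K f X.
have key : g`_1 = g`_3 * (x1 * x2 + x1 * x3 + x2 * x3)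
                  + 2%:R * l * (y1 - l * x1).
  move: e1 e2; rewrite !hornerG /x3 => e1 e2.
  have [ex|nex] := eqVneq x1 x2.
    have [_ y0] := y12 ex.
    have : l * (2%:R * y1) = g^`().[x1].
      by rewrite /l /ec_slope ex eqxx divfK // mulf_neq0.
    rewrite horner_derivG -ex => el.
    have -> : g`_1 = l * (2%:R * y1) - 3%:R * g`_3 * x1 ^+ 2 - 2%:R * g`_2 * x1.
      by rewrite el; ring.
    by field.
  have nz : x2 - x1 != 0 by rewrite subr_eq0 eq_sym.
  apply: (mulfI nz).
  have -> : (x2 - x1) * g`_1 = y2 ^+ 2 - y1 ^+ 2 - g`_3 * (x2 ^+ 3 - x1 ^+ 3)
     - g`_2 * (x2 ^+ 2 - x1 ^+ 2) by rewrite e1 e2; ring.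
  by rewrite ey2; field.
have key0 : g`_0 = (y1 - l * x1) ^+ 2 - g`_3 * x1 * x2 * x3.
  have -> : g`_0 = y1 ^+ 2 - g`_3 * x1 ^+ 3 - g`_2 * x1 ^+ 2 - g`_1 * x1.
    by rewrite e1 hornerG; ring.
  by rewrite key /x3; field.
have key2 : g`_2 = l ^+ 2 - g`_3 * (x1 + x2 + x3) by rewrite /x3; field.
rewrite {}key {}key0 {}key2; clearbody x3 l.
rewrite !(rmorphB, rmorphD, rmorphM, rmorphXn, rmorph_nat) /=; ring.
Qed.

Lemma add_on_curve P Q : on_curve P -> on_curve Q -> on_curve (add_coords P Q).
Proof.
case: P Q => [[x1 y1]|] [[x2 y2]|] //= /eqP e1 /eqP e2.
case: ifPn => // nopp; case: (lineP e1 e2 nopp) => _ _ ln /=.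
set x3 := _ - x1 - x2; have := ln F idfun x3; rewrite /= -/x3 subrr mulr0 -hornerG.
by move=> /eqP; rewrite subr_eq0 eq_sym sqrrN.
Qed.

Definition ec_zero : ec_point := @Point None isT.
Definition ec_opp (P : ec_point) : ec_point := Point (opp_on_curve (valP P)).
Definition ec_add (P Q : ec_point) : ec_point :=
  Point (add_on_curve (valP P) (valP Q)).

Lemma ec_addC : commutative ec_add.
Proof.
case=> [[[x1 y1]|] c1] [[[x2 y2]|] c2]; apply: val_inj => //=.
have e1 := eqP c1; have e2 := eqP c2.
rewrite [x2 == x1]eq_sym [y2 == - y1]eq_sym eqr_oppLR.
case: ifPn => // nopp.
case: (lineP e1 e2 nopp) => ey _ _.
have -> : ec_slope x2 y2 x1 y1 = ec_slope x1 y1 x2 y2.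
  rewrite /ec_slope [x2 == _]eq_sym; case: eqVneq => [ex|nex].
    by rewrite ey ex subrr mulr0 addr0.
  by rewrite -opprB -[x1 - _]opprB invrN mulrNN.
move: (ec_slope _ _ _ _) ey => l ->; congr (Some (_, _)); ring.
Qed.

Lemma ec_add0 : left_id ec_zero ec_add.
Proof. by case=> [P c]; apply: val_inj. Qed.

Lemma ec_addN : left_inverse ec_zero ec_opp ec_add.
Proof. by case=> [[[x y]|] c]; apply: val_inj => //=; rewrite !eqxx. Qed.


(* Associativity is proved through ideal classes: fring is the coordinate ring
   F['X, Y] / (Y^2 - g), the pair (u, v) standing for u + v * Y.  The ideal of
   P + Q is in the class of the product of the ideals of P and Q (simI_add), and
   a point is determined by the class of its ideal (vanish_inj). *)
Definition fring : Type := ({poly F} * {poly F})%type.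
HB.instance Definition _ := GRing.Zmodule.copy fring ({poly F} * {poly F})%type.

Definition fmul (u v : fring) : fring :=
  (u.1 * v.1 + u.2 * v.2 * g, u.1 * v.2 + u.2 * v.1).

Lemma fringE (u v : fring) : (u = v) <-> (u.1 = v.1 /\ u.2 = v.2).
Proof. by case: u v => [a b] [c d] /=; split=> [[-> ->]|[-> ->]]. Qed.

Lemma fmulA : associative fmul.
Proof. by move=> u v w; apply/fringE; split=> /=; ring. Qed.
Lemma fmulC : commutative fmul.
Proof. by move=> u v; apply/fringE; split=> /=; ring. Qed.
Lemma fmul1 : left_id ((1, 0) : fring) fmul.
Proof. by move=> u; apply/fringE; split=> /=; ring. Qed.
Lemma fmulD : left_distributive fmul +%R.
Proof. by move=> u v w; apply/fringE; split=> /=; ring. Qed.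
Lemma fone_neq0 : ((1, 0) : fring) != 0.
Proof. by rewrite xpair_eqE oner_eq0. Qed.
HB.instance Definition _ :=
  GRing.Zmodule_isComNzRing.Build fring fmulA fmulC fmul1 fmulD fone_neq0.

Definition fpoly (p : {poly F}) : fring := (p, 0).
Lemma fpoly_zmod : zmod_morphism fpoly.
Proof. by move=> p q; apply/fringE; rewrite /= subrr. Qed.
Lemma fpoly_monoid : monoid_morphism fpoly.
Proof. by split=> // p q; apply/fringE; split => /=; ring. Qed.
HB.instance Definition _ :=
  GRing.isZmodMorphism.Build {poly F} fring fpoly fpoly_zmod.
HB.instance Definition _ :=
  GRing.isMonoidMorphism.Build {poly F} fring fpoly fpoly_monoid.

Definition fnorm (u : fring) : {poly F} := u.1 ^+ 2 - u.2 ^+ 2 * g.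
Lemma fnormM (u v : fring) : fnorm (u * v) = fnorm u * fnorm v.
Proof. rewrite /fnorm /=; ring. Qed.

Lemma size_fnorm (u : fring) :
  size (fnorm u) = maxn (size u.1).*2.-1 (if u.2 == 0 then 0 else (size u.2).*2.+2).
Proof.
have szX (p : {poly F}) : size (p ^+ 2) = (size p).*2.-1.
  have [->|nz] := eqVneq p 0; first by rewrite expr0n size_poly0.
  by rewrite expr2 size_mul // addnn.
have gnz : g != 0 by rewrite -size_poly_eq0 size_cubic.
rewrite /fnorm; case: eqVneq => [->|nz].
  by rewrite expr0n mul0r subr0 szX maxn0.
have sz2 : size (u.2 ^+ 2 * g) = (size u.2).*2.+2.
  rewrite size_mul ?expf_neq0 // szX size_cubic addnS /=.
  by case: (size u.2) (size_poly_eq0 u.2) => [|n _]; rewrite ?(negPf nz) // doubleS /= !addnS addn0.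
case: (ltngtP (size (u.1 ^+ 2)) (size (u.2 ^+ 2 * g))) => h.
- by rewrite addrC size_polyDl size_polyN -?szX // sz2 (maxn_idPr _) // -sz2 ltnW.
- by rewrite size_polyDl ?size_polyN -?szX // (maxn_idPl _) // -sz2 ltnW.
move: h; rewrite szX sz2; case: (size u.1) => [//|n]; rewrite doubleS /= => /eqP.
by rewrite eqSS => /eqP /(congr1 odd); rewrite /= !odd_double.
Qed.

Lemma fnorm_eq0 (u : fring) : (fnorm u == 0) = (u == 0).
Proof.
apply/idP/idP => [|/eqP ->]; last by rewrite /fnorm /= expr0n mul0r subrr.
rewrite -size_poly_eq0 size_fnorm -leqn0 geq_max !leqn0.
case: (u.2 =P 0) => [u20|_] /andP[h1 h2] //.
have /eqP : u.1 == 0 by rewrite -size_poly_eq0; case: (size u.1) h1 => // n; rewrite doubleS.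
by move=> u10; apply/eqP/fringE.
Qed.

Lemma fmulI (u v w : fring) : u != 0 -> u * v = u * w -> v = w.
Proof.
move=> nz /eqP; rewrite -subr_eq0 -mulrBr -fnorm_eq0 fnormM mulf_eq0.
by rewrite !fnorm_eq0 (negPf nz) /= subr_eq0 => /eqP.
Qed.

Lemma fmul_neq0 (u v : fring) : u != 0 -> v != 0 -> u * v != 0.
Proof. by rewrite -!fnorm_eq0 fnormM mulf_eq0 negb_or => -> ->. Qed.

Definition feval (x y : F) (u : fring) : F := u.1.[x] + u.2.[x] * y.

(* At infinity this is the unit ideal. *)
Definition vanish (P : option (F * F)) (u : fring) : Prop :=
  if P is Some (x, y) then feval x y u = 0 else True.

Inductive prodI (I J : fring -> Prop) : fring -> Prop :=
| prodI0 : prodI I J 0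
| prodID i j z : I i -> J j -> prodI I J z -> prodI I J (i * j + z).

Definition simI (I J : fring -> Prop) : Prop :=
  exists a b : fring, [/\ a != 0, b != 0,
    forall i, I i -> exists2 j, J j & a * i = b * j &
    forall j, J j -> exists2 i, I i & b * j = a * i].

Lemma simI_refl I : simI I I.
Proof.
by exists 1, 1; split; rewrite ?oner_eq0 // => i Ii; exists i.
Qed.

Lemma simI_sym I J : simI I J -> simI J I.
Proof. by move=> [a [b [a0 b0 ab ba]]]; exists b, a. Qed.

Lemma simI_trans I J K : simI I J -> simI J K -> simI I K.
Proof.
move=> [a [b [a0 b0 ab ba]]] [c [d [c0 d0 cd dc]]].
exists (c * a), (b * d); split; try exact: fmul_neq0.
- move=> i /ab[j /cd[k Kk e2] e1]; exists k => //.
  by rewrite -mulrA e1 -mulrA -e2; ring.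
- move=> k /dc[j /ba[i Ii e1] e2]; exists i => //.
  by rewrite -!mulrA -e1 e2; ring.
Qed.

Lemma simI_prod I J K : simI I J -> simI (prodI I K) (prodI J K).
Proof.
move=> [a [b [a0 b0 ab ba]]]; exists a, b; split=> //.
- move=> z; elim => [|i k w /ab[j Jj e] Kk _ [v Iv ew]].
    by exists 0; [exact: prodI0 | rewrite !mulr0].
  by exists (j * k + v); [exact: prodID | rewrite !mulrDr !mulrA e ew].
- move=> z; elim => [|i k w /ba[j Jj e] Kk _ [v Iv ew]].
    by exists 0; [exact: prodI0 | rewrite !mulr0].
  by exists (j * k + v); [exact: prodID | rewrite !mulrDr !mulrA e ew].
Qed.

Lemma prodI1 (I J : fring -> Prop) i j : I i -> J j -> prodI I J (i * j).
Proof. by move=> Ii Jj; rewrite -[_ * _]addr0; apply: prodID => //; exact: prodI0. Qed.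

Lemma prodI_add I J (u v : fring) : prodI I J u -> prodI I J v -> prodI I J (u + v).
Proof.
by move=> Iu Iv; elim: Iu => [|i j z Ii Jj _ h]; rewrite ?add0r // -addrA; exact: prodID.
Qed.

Lemma prodI_comm I J z : prodI I J z -> prodI J I z.
Proof.
elim=> [|i j w Ii Jj _ h]; first exact: prodI0.
by rewrite mulrC; exact: prodID.
Qed.

Lemma prodI_assoc I J K z : prodI (prodI I J) K z -> prodI I (prodI J K) z.
Proof.
elim=> [|w k v + Kk _ h]; first exact: prodI0.
move=> IJw; apply: prodI_add => {v h}//.
elim: IJw => [|i j v Ii Jj _ h]; first by rewrite mul0r; exact: prodI0.
by rewrite mulrDl -mulrA; apply: prodID => //; exact: prodI1.
Qed.

Lemma prodI_assoc' I J K z : prodI I (prodI J K) z -> prodI (prodI I J) K z.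
Proof.
elim=> [|i w v Ii + _ h]; first exact: prodI0.
move=> JKw; apply: prodI_add => {v h}//.
elim: JKw => [|j k v Jj Kk _ h]; first by rewrite mulr0; exact: prodI0.
by rewrite mulrDr mulrA; apply: prodID => //; exact: prodI1.
Qed.

Lemma simI_eq I J : (forall z, I z <-> J z) -> simI I J.
Proof.
move=> IJ; exists 1, 1; split; rewrite ?oner_eq0 // => i /IJ ?; by exists i.
Qed.

Lemma fadd1 (u v : fring) : (u + v).1 = u.1 + v.1. Proof. by []. Qed.
Lemma fadd2 (u v : fring) : (u + v).2 = u.2 + v.2. Proof. by []. Qed.
Lemma fopp1 (u : fring) : (- u).1 = - u.1. Proof. by []. Qed.
Lemma fopp2 (u : fring) : (- u).2 = - u.2. Proof. by []. Qed.
Lemma fmul1E (u v : fring) : (u * v).1 = u.1 * v.1 + u.2 * v.2 * g.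
Proof. by []. Qed.
Lemma fmul2E (u v : fring) : (u * v).2 = u.1 * v.2 + u.2 * v.1.
Proof. by []. Qed.
Definition fcoordE := (fadd1, fadd2, fopp1, fopp2, fmul1E, fmul2E).

Lemma feval_add x y (u v : fring) : feval x y (u + v) = feval x y u + feval x y v.
Proof. rewrite /feval ?fcoordE /= !(hornerD, hornerN, hornerM, hornerC, hornerX); ring. Qed.

Lemma feval_mul x y (u v : fring) : y ^+ 2 = g.[x] ->
  feval x y (u * v) = feval x y u * feval x y v.
Proof. by move=> e; rewrite /feval ?fcoordE /= !(hornerD, hornerN, hornerM, hornerC, hornerX) -e; ring. Qed.

Lemma vanish0 P : vanish P 0.
Proof. by case: P => [[x y]|] //=; rewrite /feval !horner0 mul0r addr0. Qed.

Lemma vanishD P (u v : fring) : vanish P u -> vanish P v -> vanish P (u + v).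
Proof. by case: P => [[x y]|] //= hu hv; rewrite feval_add hu hv addr0. Qed.

Lemma vanishM P (u v : fring) : on_curve P -> vanish P u -> vanish P (v * u).
Proof. by case: P => [[x y]|] //= /eqP e hu; rewrite feval_mul // hu mulr0. Qed.

Local Notation "c %:F" := (fpoly c%:P) (format "c %:F").
Local Notation Xf := (fpoly 'X).
Definition fY : fring := (0, 1).

Lemma fY2 : fY ^+ 2 = fpoly g.
Proof. by rewrite expr2; apply/fringE; split; rewrite /= ?mul0r ?mulr0 ?mul1r ?add0r. Qed.

Lemma vanishP x y u : y ^+ 2 = g.[x] -> vanish (Some (x, y)) u ->
  exists a b, u = a * (Xf - x%:F) + b * (fY - y%:F).
Proof.
move=> exy hu.
have /factor_theorem[q eq] : root (u.1 + u.2 * y%:P) x.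
  by rewrite /root !hornerE; apply/eqP.
exists (fpoly q), (fpoly u.2); apply/fringE; split => /=; last by ring.
have -> : u.1 = q * ('X - x%:P) - u.2 * y%:P by rewrite -eq addrK.
by ring.
Qed.


Lemma fevalX x y : feval x y Xf = x.
Proof. by rewrite /feval /= !hornerE. Qed.
Lemma fevalC x y c : feval x y c%:F = c.
Proof. by rewrite /feval /= !hornerE. Qed.
Lemma fevalY x y : feval x y fY = y.
Proof. by rewrite /feval /= !hornerE. Qed.
Lemma fevalN x y (u : fring) : feval x y (- u) = - feval x y u.
Proof. rewrite /feval ?fcoordE /= !(hornerD, hornerN, hornerM, hornerC, hornerX); ring. Qed.

Lemma vanishX x y : vanish (Some (x, y)) (Xf - x%:F).
Proof. by rewrite /= feval_add fevalN fevalX fevalC subrr. Qed.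
Lemma vanishY x y : vanish (Some (x, y)) (fY - y%:F).
Proof. by rewrite /= feval_add fevalN fevalY fevalC subrr. Qed.

Lemma fX_neq0 x : Xf - x%:F != 0.
Proof. by rewrite -rmorphB xpair_eqE polyXsubC_eq0. Qed.

Lemma fconstV c : c != 0 -> c%:F * c^-1%:F = 1.
Proof. by move=> nz; rewrite -!rmorphM /= divff // !rmorph1. Qed.

Lemma fpoly_cubic :
  fpoly g = (g`_3)%:F * Xf ^+ 3 + (g`_2)%:F * Xf ^+ 2 + (g`_1)%:F * Xf + (g`_0)%:F.
Proof.
rewrite {1}cubicE -!mul_polyC mulr1.
have XE n : fpoly 'X^n = Xf ^+ n := rmorphXn _ _ _.
by rewrite !rmorphD /= ![fpoly (_ * _)]rmorphM /= !XE.
Qed.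

Lemma simI_opp x y : y ^+ 2 = g.[x] ->
  simI (prodI (vanish (Some (x, y))) (vanish (Some (x, - y)))) (vanish None).
Proof.
move=> e; have ch2 := char_neq2 E.
have eN : (- y) ^+ 2 = g.[x] by rewrite sqrrN.
have /factor_theorem[k ek] : root (g - (y ^+ 2)%:P) x.
  by rewrite /root !hornerE e subrr.
have vv : (fY - y%:F) * (fY - (- y)%:F) = fpoly k * (Xf - x%:F).
  rewrite -rmorphB -rmorphM -ek rmorphB /= -fY2 !rmorphXn !rmorphN /=; ring.
exists 1, (Xf - x%:F); split; first exact: oner_neq0; first exact: fX_neq0.
- move=> z; elim=> [|i j w /(vanishP e)[a [b ->]] /(vanishP eN)[c [d ->]] _ [v _ ev]].
    by exists 0; rewrite ?mulr0.
  exists (a * c * (Xf - x%:F) + a * d * (fY - (- y)%:F) + b * c * (fY - y%:F)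
          + b * d * fpoly k + v) => //.
  have -> : forall A B C D : fring, 1 * ((a * A + b * B) * (c * A + d * C) + D) =
    A * (a * c * A + a * d * C + b * c * B) + b * d * (B * C) + 1 * D.
    by move=> *; ring.
  by rewrite vv ev; ring.
- move=> z _; exists ((Xf - x%:F) * z); last by rewrite mul1r.
  suff h : prodI (vanish (Some (x, y))) (vanish (Some (x, - y))) (Xf - x%:F).
    elim: h z => [|i j w Ii Jj _ h] z; first by rewrite mul0r; exact: prodI0.
    rewrite mulrDl -mulrA [j * z]mulrC; apply: prodID => //.
    by apply: vanishM => //; rewrite /= sqrrN e.
  have pm : forall u v w, vanish (Some (x, y)) u -> vanish (Some (x, - y)) v ->
    prodI (vanish (Some (x, y))) (vanish (Some (x, - y))) (w * u * v).
    by move=> u v w hu hv; apply: prodI1 => //; apply: vanishM => //; rewrite /= e.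
  have [y0|y0] := eqVneq y 0; last first.
    have c2 : 2%:R * y != 0 by rewrite mulf_neq0.
    have -> : Xf - x%:F = (2%:R * y)^-1%:F * (Xf - x%:F) * (fY - (- y)%:F)
         + (- (2%:R * y)^-1%:F * (fY - y%:F)) * (Xf - x%:F).
      rewrite -[LHS]mul1r -(fconstV c2) !rmorphM !rmorphN !rmorph_nat /=; ring.
    by apply: prodI_add; apply: pm; [exact: vanishX| exact: vanishY | exact: vanishY | exact: vanishX].
  have k0 : k.[x] != 0.
    have := cubic_smooth e y0; have -> : g = k * ('X - x%:P) + (y ^+ 2)%:P by rewrite -ek subrK.
    by rewrite derivD derivM derivXsubC derivC !hornerE subrr mulr0 add0r.
  have /factor_theorem[q eq] : root (k - (k.[x])%:P) x by rewrite /root !hornerE subrr.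
  have ekF : fpoly k = fpoly q * (Xf - x%:F) + (k.[x])%:F.
    by rewrite -rmorphB -rmorphM -eq rmorphB subrK.
  have -> : Xf - x%:F = (k.[x]^-1)%:F * (fY - y%:F) * (fY - (- y)%:F)
     + - ((k.[x]^-1)%:F * fpoly q) * (Xf - x%:F) * (Xf - x%:F).
    rewrite -[_ * _ * (fY - _)]mulrA vv ekF -[LHS]mul1r -(fconstV k0); ring.
  by apply: prodI_add; apply: pm; [exact: vanishY| exact: vanishY | exact: vanishX | exact: vanishX].
Qed.

Lemma simI_line x1 y1 x2 y2 : y1 ^+ 2 = g.[x1] -> y2 ^+ 2 = g.[x2] ->
  ~~ ((x1 == x2) && (y1 == - y2)) ->
  simI (prodI (vanish (Some (x1, y1))) (vanish (Some (x2, y2))))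
       (vanish (add_coords (Some (x1, y1)) (Some (x2, y2)))).
Proof.
move=> e1 e2 nopp; have := @add_on_curve (Some (x1, y1)) (Some (x2, y2)).
rewrite /on_curve e1 e2 !eqxx => /(_ isT isT).
have ch2 := char_neq2 E.
have [ey ny ln] := lineP e1 e2 nopp.
rewrite /= (negPf nopp); move: (ec_slope x1 y1 x2 y2) ey ln => l ey.
move: (_ - x1 - x2) => x3 ln /eqP e3.
set y3 := - _ in e3 *.
have {ln} := ln fring (fpoly \o polyC) Xf; rewrite /= -fpoly_cubic -fY2.
pose u1 := Xf - x1%:F; pose u2 := Xf - x2%:F; pose u3 := Xf - x3%:F.
rewrite -/u1 -/u2 -/u3 => ln.
pose L := fY - (y1%:F + l%:F * u1); pose M := fY + (y1%:F + l%:F * u1).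
set c := g`_3 in ln; have c0 : c != 0 := lead_neq0.
have LM : L * M = c%:F * u1 * u2 * u3 by rewrite -ln /L /M; ring.
have pP u : vanish (Some (x1, y1)) u -> exists a b, u = a * u1 + b * L.
  move=> /(vanishP e1)[a [b ->]]; exists (a + b * l%:F), b; rewrite /L /u1; ring.
have pQ u : vanish (Some (x2, y2)) u -> exists a b, u = a * u2 + b * L.
  move=> /(vanishP e2)[a [b ->]]; exists (a + b * l%:F), b.
  by rewrite /L /u2 /u1 ey !(rmorphD, rmorphM, rmorphB, rmorphN) /=; ring.
have pR u : vanish (Some (x3, y3)) u -> exists a b, u = a * u3 + b * M.
  move=> /(vanishP e3)[a [b ->]]; exists (a - b * l%:F), b.
  by rewrite /M /u3 /u1 /y3 !(rmorphD, rmorphM, rmorphB, rmorphN) /=; ring.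
have L1 : vanish (Some (x1, y1)) L.
  by rewrite /L /u1 /= !(feval_add, fevalN, feval_mul _ _ e1, fevalX, fevalY, fevalC); ring.
have L2 : vanish (Some (x2, y2)) L.
  by rewrite /L /u1 /= !(feval_add, fevalN, feval_mul _ _ e2, fevalX, fevalY, fevalC) ey; ring.
have M3 : vanish (Some (x3, y3)) M.
  by rewrite /M /u1 /= !(feval_add, fevalN, feval_mul _ _ e3, fevalX, fevalY, fevalC) /y3; ring.
have U1 : vanish (Some (x1, y1)) u1 := vanishX _ _.
have U2 : vanish (Some (x2, y2)) u2 := vanishX _ _.
have U3 : vanish (Some (x3, y3)) u3 := vanishX _ _.
have [a [b [d one]]] : exists a b d, a * u1 + b * u2 + d * (M - L) = 1.
  have [ex|nx] := eqVneq x1 x2.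
    have h : 2%:R * y1 != 0 by rewrite mulf_neq0 // ny.
    exists (- (2%:R * y1)^-1%:F * (2%:R * l%:F)), 0, (2%:R * y1)^-1%:F.
    have h2 : (2%:R * y1)%:F = 2%:R * y1%:F by rewrite !rmorphM !rmorph_nat.
    by rewrite -[RHS](fconstV h) h2 /M /L; ring.
  have h : x2 - x1 != 0 by rewrite subr_eq0 eq_sym.
  exists (x2 - x1)^-1%:F, (- (x2 - x1)^-1%:F), 0.
  have h2 : (x2 - x1)%:F = x2%:F - x1%:F by rewrite !rmorphB.
  by rewrite -[RHS](fconstV h) h2 /u1 /u2; ring.
have on1 : on_curve (Some (x1, y1)) by rewrite /= e1.
have on2 : on_curve (Some (x2, y2)) by rewrite /= e2.
have on3 : on_curve (Some (x3, y3)) by rewrite /= e3.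
have M0 : M != 0.
  apply/eqP => /fringE [_] /=; rewrite !(mulr0, mul0r, addr0, subr0, oppr0) => /eqP.
  by rewrite oner_eq0.
exists M, (u1 * u2); split => //; first by apply: fmul_neq0; exact: fX_neq0.
- move=> z; elim=> [|i j w /pP[a1 [b1 ->]] /pQ[a2 [b2 ->]] _ [v Rv ev]].
    by exists 0; [exact: vanish0 | rewrite !mulr0].
  exists (a1 * a2 * M + (c%:F * (a1 * b2 * u1 + b1 * a2 * u2 + b1 * b2 * L)) * u3 + v).
    by do 2?[apply: vanishD => //]; apply: vanishM.
  have -> : M * ((a1 * u1 + b1 * L) * (a2 * u2 + b2 * L) + w) =
    M * a1 * a2 * u1 * u2 + (L * M) * (a1 * b2 * u1 + b1 * a2 * u2 + b1 * b2 * L) + M * w.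
    by ring.
  by rewrite LM ev; ring.
- move=> z /pR[r [s ->]].
  pose w := (r * (c^-1%:F * a) * u1) * L + (r * (c^-1%:F * b) * L) * u2
      + (- (r * (c^-1%:F * d)) * L) * L + (r * d * u3 * u1) * u2 + (s * u1) * u2.
  exists w.
    by rewrite /w; do 4?[apply: prodI_add]; apply: prodI1 => //; apply: vanishM.
  have -> : M * w = (L * M) * (r * c^-1%:F * (a * u1 + b * u2 - d * L)) 
       + r * d * u1 * u2 * u3 * M + s * u1 * u2 * M by rewrite /w; ring.
  rewrite LM; have -> : r * c^-1%:F * (a * u1 + b * u2 - d * L) =
     r * c^-1%:F * (1 - d * M) by rewrite -one; ring.
  have -> : c%:F * u1 * u2 * u3 * (r * c^-1%:F * (1 - d * M)) =
    (c%:F * c^-1%:F) * (u1 * u2 * u3 * (r * (1 - d * M))) by ring.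
  rewrite fconstV //; ring.
Qed.

Lemma simI_add P Q : on_curve P -> on_curve Q ->
  simI (prodI (vanish P) (vanish Q)) (vanish (add_coords P Q)).
Proof.
have idl R : on_curve R -> simI (prodI (vanish None) (vanish R)) (vanish R).
  move=> oR; apply: simI_eq => z; split=> [|Rz]; last first.
    by rewrite -[z]mul1r; apply: prodI1.
  elim=> [|i j w _ Rj _ Rw]; last by apply: vanishD => //; apply: vanishM.
  exact: vanish0.
case: P => [[x1 y1]|] oP; last by move=> oQ; exact: idl.
case: Q => [[x2 y2]|] oQ; last first.
  apply: simI_trans (idl _ oP); apply: simI_eq => z; split; exact: prodI_comm.
have e1 := eqP oP; have e2 := eqP oQ.
have [/andP[/eqP ex /eqP ey]|nopp] := boolP ((x1 == x2) && (y1 == - y2)).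
  rewrite /= ex ey !eqxx /=; subst x1 y1.
  by rewrite -{2}[y2]opprK; apply: simI_opp; rewrite sqrrN.
exact: simI_line.
Qed.

Lemma small_fnorm (u : fring) : u != 0 -> (size (fnorm u) <= 3)%N ->
  u.2 = 0 /\ (size u.1 <= 2)%N.
Proof.
move=> nz; rewrite size_fnorm geq_max; case: (u.2 =P 0) => [-> /andP[h _]|n2].
  by split => //; case: (size u.1) h => [|[|[|n]]] //; rewrite !doubleS.
have : (0 < size u.2)%N by rewrite size_poly_gt0; apply/eqP.
by case: (size u.2) => // n _; rewrite doubleS andbF.
Qed.


Lemma size_fnorm_vanish x y (u : fring) : y ^+ 2 = g.[x] -> u != 0 ->
  vanish (Some (x, y)) u -> (2 < size (fnorm u))%N.
Proof.
move=> e nz hu.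
have r : root (fnorm u) x.
  move: hu; rewrite /root /fnorm /= /feval !(hornerD, hornerN, hornerM, horner_exp) -e => h.
  have -> : forall A B : F, A * A - B * B * y ^+ 2 = (A - B * y) * (A + B * y).
    by move=> A B; ring.
  by rewrite h mulr0.
have := root_size_gt1 _ r; rewrite fnorm_eq0 => /(_ nz).
rewrite leq_eqVlt => /orP[/eqP h|//].
have [] := small_fnorm nz; first by rewrite -h.
move=> u2 _; move: h; rewrite size_fnorm u2 eqxx maxn0.
by case: (size u.1) => // n; rewrite doubleS /= => -[] /(congr1 odd); rewrite /= odd_double.
Qed.

Lemma fnormX x : fnorm (Xf - x%:F) = ('X - x%:P) ^+ 2.
Proof. by rewrite -rmorphB /fnorm /= expr0n mul0r subr0. Qed.

Lemma vanish_inj P Q : on_curve P -> on_curve Q ->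
  simI (vanish P) (vanish Q) -> P = Q.
Proof.
have aux x y : y ^+ 2 = g.[x] -> ~ simI (vanish (Some (x, y))) (vanish None).
  move=> e [a [b [a0 b0 ab /(_ 1 I)[h' V' e']]]].
  have [h _ e1] := ab _ (vanishX x y); have [k _ e2] := ab _ (vanishY x y).
  rewrite mulr1 in e'; rewrite {}e' -!mulrA in e1 e2 b0 *.
  have {}e1 := fmulI a0 e1; have {}e2 := fmulI a0 e2.
  have h'0 : h' != 0 by apply: contraNneq b0 => ->; rewrite mulr0.
  have h0 : h != 0 by have := fX_neq0 x; apply: contraNneq => h0; rewrite e1 h0 mulr0.
  have s' := size_fnorm_vanish e h'0 V'.
  have := congr1 (size \o fnorm) e1; rewrite /= fnormX fnormM.
  rewrite size_exp_XsubC size_mul ?fnorm_eq0 // => sz.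
  have : (0 < size (fnorm h))%N by rewrite size_poly_gt0 fnorm_eq0.
  move=> sh; have [] := small_fnorm h'0.
    move: sz sh; case: (size (fnorm h)) => // n; rewrite addnS /= => -> _.
    exact: leq_addr.
  move=> h2 _; have := congr1 snd e2.
  rewrite /= h2 mul0r addr0 subr0 => e3.
  move: V'; rewrite /= /feval h2 horner0 mul0r addr0 => V'.
  have := congr1 (horner^~ x) e3; rewrite /= hornerM V' mul0r hornerC => /eqP.
  by rewrite oner_eq0.
case: P Q => [[x y]|] [[x' y']|] // oP oQ; last 2 first.
- by case/aux; apply/eqP.
- by move=> /simI_sym; case/aux; apply/eqP.
have e := eqP oP; have e' := eqP oQ.
move=> [a [b [a0 b0 ab ba]]].
have [h Vh e1] := ab _ (vanishX x y); have [k Vk e2] := ab _ (vanishY x y).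
have [h' Vh' e3] := ba _ (vanishX x' y').
have hh : (Xf - x%:F) * (Xf - x'%:F) = h * h'.
  apply: (fmulI (fmul_neq0 a0 b0)).
  have -> : a * b * ((Xf - x%:F) * (Xf - x'%:F)) =
    (a * (Xf - x%:F)) * (b * (Xf - x'%:F)) by ring.
  rewrite e1 e3; ring.
have : h * h' != 0 by rewrite -hh fmul_neq0 ?fX_neq0.
rewrite -fnorm_eq0 fnormM mulf_eq0 !fnorm_eq0 negb_or => /andP[h0 h'0].
have s1 := size_fnorm_vanish e' h0 Vh; have s2 := size_fnorm_vanish e h'0 Vh'.
have := congr1 (size \o fnorm) hh; rewrite /= !fnormM !fnormX.
rewrite size_mul ?expf_neq0 ?polyXsubC_eq0 // !size_exp_XsubC.
rewrite size_mul ?fnorm_eq0 // => sz.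
have [] := small_fnorm h0.
  move: sz s2; case: (size (fnorm h')) => [|[|[|m]]] //; rewrite !addnS addn0 /=.
  by move=> -[->] _; exact: leq_addr.
move=> h2 sh1.
have hk : h * (fY - y%:F) = k * (Xf - x%:F).
  apply: (fmulI b0); rewrite mulrA -e1 mulrA -e2; ring.
have := congr1 fst hk; have := congr1 snd hk.
rewrite /= h2 !(mul0r, mulr0, addr0, add0r, subr0, mulr1, sub0r, oppr0) => q2 q1.
have h10 : h.1 != 0.
  by apply: contraNneq h0 => h1; apply/eqP/fringE.
have k20 : k.2 != 0 by apply: contraNneq h10 => k2; rewrite q2 k2 mul0r.
have sk : (size k.2 <= 1)%N.
  by move: sh1; rewrite q2 size_Mmonic ?monicXsubC // size_XsubC addn2.
have [c c0 kc] : exists2 c, c != 0 & k.2 = c%:P.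
  by apply/size_poly1P; rewrite eqn_leq sk size_poly_gt0.
have k1 : k.1 = - y%:P * k.2.
  have X0 : 'X - x%:P != 0 by rewrite polyXsubC_eq0.
  by apply: (mulIf X0); rewrite -q1 q2; ring.
have : h.1.[x'] = 0 by move: Vh; rewrite /= /feval h2 horner0 mul0r addr0.
rewrite q2 kc hornerM hornerXsubC hornerC => /eqP; rewrite mulf_eq0 (negPf c0) subr_eq0.
move=> /eqP ex; congr (Some (_, _)) => //.
move: Vk; rewrite /= /feval k1 kc !(hornerM, hornerN, hornerC) => /eqP.
have -> : - y * c + c * y' = c * (y' - y) by ring.
by rewrite mulf_eq0 (negPf c0) subr_eq0 => /eqP.
Qed.

Lemma ec_addA : associative ec_add.
Proof.
move=> P Q R; have [oP oQ oR] := And3 (valP P) (valP Q) (valP R).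
have oPQ := add_on_curve oP oQ; have oQR := add_on_curve oQ oR.
apply/val_inj/vanish_inj; try exact: valP.
apply: simI_trans (simI_sym (simI_add oP oQR)) _.
apply: simI_trans _ (simI_add oPQ oR).
apply: (@simI_trans _ (prodI (vanish P) (prodI (vanish Q) (vanish R)))).
  apply: (@simI_trans _ (prodI (vanish (add_coords Q R)) (vanish P))).
    by apply: simI_eq => z; split; exact: prodI_comm.
  apply: (@simI_trans _ (prodI (prodI (vanish Q) (vanish R)) (vanish P))).
    by apply/simI_prod/simI_sym/simI_add.
  by apply: simI_eq => z; split; exact: prodI_comm.
apply: (@simI_trans _ (prodI (prodI (vanish P) (vanish Q)) (vanish R))).
  by apply: simI_eq => z; split; [exact: prodI_assoc'|exact: prodI_assoc].
by apply/simI_prod/simI_add.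
Qed.

HB.instance Definition _ :=
  GRing.isZmodule.Build ec_point ec_addA ec_addC ec_add0 ec_addN.

End Points.

Definition zfree (G : zmodType) (n : nat) (v : 'I_n -> G) : Prop :=
  forall m : 'I_n -> int, \sum_(i < n) v i *~ m i = 0 -> forall i, m i = 0.

(* The rank of an abelian group: the largest size of a Z-linearly independent
   family, +oo if these sizes are unbounded, so that it is a total notion; for G
   finitely generated it is the rank of the free part. *)
Definition zrank (G : zmodType) : \bar rat :=
  ereal_sup [set e | exists2 n : nat,
    (exists v : 'I_n -> G, zfree v) & e = n%:R%:E]%classic.

Lemma zfree_widen (G : zmodType) m n (v : 'I_n -> G) :
  (m <= n)%N -> zfree v -> exists w : 'I_m -> G, zfree w.
Proof.
move=> mn fv; exists (fun i => v (widen_ord mn i)) => c s0 i.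
pose d (j : 'I_n) : int := if insub (val j) is Some k then c k else 0.
have dE k : d (widen_ord mn k) = c k by rewrite /d /= valK.
rewrite -dE; apply: fv; rewrite -[RHS]s0.
rewrite (bigID (fun j : 'I_n => (j < m)%N)) /= [X in _ + X]big1 ?addr0; last first.
  by move=> j jm; rewrite /d insubN.
rewrite (big_ord_narrow mn).
by apply: eq_bigr => k _; rewrite dE.
Qed.

Lemma zrank_geP (G : zmodType) (n : nat) :
  (n%:R%:E <= zrank G)%E <-> exists v : 'I_n -> G, zfree v.
Proof.
pose P k := exists v : 'I_k -> G, zfree v.
have P0 : P 0 by exists (fun=> 0) => m _ [].
have sub k l : (k <= l)%N -> P l -> P k by move=> kl [v /(zfree_widen kl)].
pose S : set (\bar rat) := [set e | exists2 k, P k & e = k%:R%:E]%classic.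
have sup (s : \bar rat) : supremums S s -> zrank G = s.
  move=> sS; rewrite /zrank /ereal_sup /supremum ifF; last first.
    by apply/negbTE/set0P; exists 0%:E, 0%N.
  by case: xgetP => [t _ /(is_subset1_supremums sS) //|/(_ s)]; case.
have [[N PN]|unb] := pselect (exists N, forall k, P k -> (k <= N)%N); last first.
  have all k : P k.
    apply: contrapT => nPk; apply: unb; exists k => l Pl.
    by rewrite leqNgt; apply/negP => /ltnW /sub /(_ Pl).
  rewrite (sup +oo%E) ?leey; first by split=> // _; exact: all.
  split=> [x _|[r|_ //|]]; first exact: leey.
  - move=> /(_ (Num.bound `|r|)%:R%:E) /= ub; have := archi_boundP (normr_ge0 r).
    have: ((Num.bound `|r|)%:R%:E <= r%:E :> \bar rat)%E by apply: ub; exists (Num.bound `|r|).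
    by rewrite lee_fin => h1 /(le_lt_trans (ler_norm r)); rewrite ltNge h1.
  - by move=> /(_ 0%:E) ub; have : (0%:E <= -oo :> \bar rat)%E by apply: ub; exists 0%N.
have [M PM maxM] : exists2 M, P M & forall k, P k -> (k <= M)%N.
  have ex : exists k, `[< P k >] by exists 0%N; apply/asboolP.
  have bd k : `[< P k >] -> (k <= N)%N by move/asboolP/PN.
  by case: (ex_maxnP ex bd) => M /asboolP PM maxM; exists M => // k Pk; apply/maxM/asboolP.
rewrite (sup M%:R%:E); last first.
  split=> [_ [k /maxM kM ->]|x]; first by rewrite lee_fin ler_nat.
  by apply; exists M.
by rewrite lee_fin ler_nat; split=> [/sub/(_ PM)|/maxM].
Qed.

Definition Ep_cubic (p : nat) : {poly rat} :=
  ('X - p%:R%:P) ^+ 3 + 'X ^+ 3 + ('X + p%:R%:P) ^+ 3.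

Lemma Ep_cubicE p :
  Ep_cubic p = 3%:R *: 'X^3 + (6%:R * p%:R ^+ 2) *: 'X.
Proof. rewrite -!mul_polyC /Ep_cubic; ring. Qed.

Lemma size_Ep_cubic p : size (Ep_cubic p) = 4.
Proof.
have s3 : size (3%:R *: 'X^3 : {poly rat}) = 4 by rewrite size_scale ?size_polyXn.
rewrite Ep_cubicE size_polyDl ?s3 //.
by apply: leq_ltn_trans (size_scale_leq _ _) _; rewrite size_polyX.
Qed.

Lemma Ep_cubic_separable p : prime p -> separable_poly (Ep_cubic p).
Proof.
move=> /prime_gt0 p0; rewrite unlock Ep_cubicE.
rewrite derivD !derivZ derivXn derivX.
have q0 : (p%:R : rat) != 0 by rewrite pnatr_eq0 -lt0n.
apply/Bezout_coprimepP.
exists ((- 27%:R) *: 'X, 9%:R *: 'X^2 + (12%:R * p%:R ^+ 2)%:P) => /=.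
rewrite [X in X %= _](_ : _ = (72%:R * p%:R ^+ 4)%:P); last by rewrite -!mul_polyC; ring.
by rewrite polyC_eqp1 mulf_neq0 // expf_neq0.
Qed.

Definition Ep (p : nat) (p_prime : prime p) : ellCurve rat :=
  EllCurve (size_Ep_cubic p) (Ep_cubic_separable p_prime) isT.

(* Meant for p prime, p = 1 %[mod 8], and a a nonzero square modulo p. *)
Definition quartic_symbol (a p : nat) : int :=
  if [exists x : 'I_p, (x ^ 4 == a %[mod p])%N] then 1 else -1.

(* Main.v *)
Require Import Defs.
From mathcomp Require Import all_boot all_order all_algebra.
From mathcomp Require Import constructive_ereal.
From mathcomp Require Import ring lra zify.
Import GRing.Theory Num.Theory.
Local Open Scope ring_scope.

(* Writing x = 3X, the map sending a point to the class of x, and T = (0, 0) to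
   the class of 2, is a homomorphism alpha from Ep(Q) to Q^* modulo squares (the
   classical 2-descent map).  The two representations provide points P1 and P2
   with alpha(P1) = p and alpha(P2) = 3p.  Since the only 2-torsion points are 0
   and T, and the class 2 = alpha(T) is not in the subgroup generated by p and
   3p, a relation m P1 + n P2 = 0 has m and n even and can be halved; descent
   gives m = n = 0. *)

Set Implicit Arguments.
Unset Strict Implicit.

(** * Square classes of a field *)

Section SquareClasses.
Variable F : fieldType.
Implicit Types u v w : F.

Definition sqeq u v := exists2 r, r != 0 & u = v * r ^+ 2.

Lemma sqeq_refl u : sqeq u u.
Proof. by exists 1; rewrite ?oner_eq0 // expr1n mulr1. Qed.

Lemma sqeq_sym u v : sqeq u v -> sqeq v u.
Proof. by case=> r r0 ->; exists r^-1; [rewrite invr_eq0|field]. Qed.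

Lemma sqeq_trans u v w : sqeq u v -> sqeq v w -> sqeq u w.
Proof.
by case=> r r0 -> [s s0 ->]; exists (s * r); [rewrite mulf_neq0|ring].
Qed.

Lemma sqeqM u v u' v' : sqeq u u' -> sqeq v v' -> sqeq (u * v) (u' * v').
Proof.
by case=> r r0 -> [s s0 ->]; exists (r * s); [rewrite mulf_neq0|ring].
Qed.

Lemma sqeq_sqr u : u != 0 -> sqeq (u * u) 1.
Proof. by move=> u0; exists u; rewrite // mul1r expr2. Qed.

Lemma sqeq_mul1 u v : v != 0 -> sqeq u v -> sqeq (u * v) 1.
Proof. by move=> v0 [r r0 ->]; exists (v * r); [rewrite mulf_neq0|ring]. Qed.

End SquareClasses.

(** * The 2-descent map for a cubic vanishing at 0 *)

Section Descent.
Variables (F : fieldType) (E : ellCurve F).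
Local Notation g := (cubic E).
Hypothesis g0 : g`_0 = 0.

(** This coefficient is the derivative of [g] at its root 0, so smoothness at T applies. *)
Lemma cubic1_neq0 : g`_1 != 0.
Proof.
have /(_ erefl) : 0 = 0 :> F -> g^`().[0] != 0.
  by apply: cubic_smooth; rewrite hornerG g0; ring.
by rewrite horner_derivG expr0n !mulr0 !add0r.
Qed.

(* The class of x after the change of variable x = g`_3 * X, which makes the
   cubic monic; at T = (0, 0), where x = 0, the value is the one forced by
   multiplicativity. *)
Definition alpha (P : option (F * F)) : F :=
  if P is Some (x, _) then if x == 0 then g`_3 * g`_1 else g`_3 * x else 1.

Lemma alpha_neq0 P : alpha P != 0.
Proof.
case: P => [[x y]|] /=; last exact: oner_neq0.
by have [_|x0] := eqVneq x 0; rewrite mulf_neq0 ?lead_neq0 ?cubic1_neq0.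
Qed.

(** On the line [y = l X + m], the constant term of [g - (l X + m)^2] makes [m^2] the leading
    coefficient times [x1 x2 x3]. If an abscissa is 0, then [m = 0] and the linear term ties the
    value at T to the other two abscissas. Since [alpha] ignores ordinates, 0 stands beside [x3]. *)
Lemma alpha_collinear (x1 y1 x2 y2 : F) :
  y1 ^+ 2 = g.[x1] -> y2 ^+ 2 = g.[x2] -> ~~ ((x1 == x2) && (y1 == - y2)) ->
  let l := ec_slope E x1 y1 x2 y2 in
  let x3 := (l ^+ 2 - g`_2) / g`_3 - x1 - x2 in
  exists s, alpha (Some (x1, y1)) * alpha (Some (x2, y2)) * alpha (Some (x3, 0))
    = s ^+ 2.
Proof.
move=> e1 e2 nopp l x3; have [_ _ line] := lineP e1 e2 nopp.
rewrite -/l -/x3 in line.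
have c0 := lead_neq0 E; have d0 := cubic1_neq0.
have eq_of_sub (a b u v : F) : a - b = v - u -> u = v -> a = b.
  by move=> h /eqP; rewrite eq_sym -subr_eq0 -h subr_eq0 => /eqP.
clearbody x3 l.
(* Comparing constant and linear coefficients on the line y = l X + m. *)
have cst : (y1 - l * x1) ^+ 2 = g`_3 * x1 * x2 * x3.
  have := line F idfun 0; rewrite /= g0; apply: eq_of_sub; ring.
have lin : y1 - l * x1 = 0 -> g`_1 = g`_3 * (x1 * x2 + x1 * x3 + x2 * x3).
  (* The values at 1 and -1 differ by twice the odd part, and the cubic terms of both sides
     agree. *)
  move=> m0; move: (line F idfun 1) (line F idfun (-1)); rewrite /= g0.
  have -> : y1 = l * x1 by apply/eqP; rewrite -subr_eq0 m0.
  move=> h1 h2; apply: (mulfI (char_neq2 E)).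
  by move: (congr2 (fun a b => b - a) h1 h2) => /=; apply: eq_of_sub; ring.
rewrite /alpha.
have x0mul : x1 * x2 * x3 = 0 -> g`_1 = g`_3 * (x1 * x2 + x1 * x3 + x2 * x3).
  move=> h; apply: lin; apply/eqP; rewrite -sqrf_eq0 cst.
  by rewrite -!mulrA [x1 * _]mulrA h mulr0.
(* Two zero abscissas would make the linear coefficient of [g] vanish. *)
have nz (u v w : F) : g`_1 = g`_3 * (u * v + u * w + v * w) -> u = 0 ->
    (v != 0) && (w != 0).
  move=> h u0; rewrite -negb_or -mulf_eq0; apply: contraNneq d0 => vw.
  by rewrite h u0 !mul0r !add0r vw mulr0.
have [x10|x10] := eqVneq x1 0.
  have h : x1 * x2 * x3 = 0 by rewrite x10 !mul0r.
  have /andP[/negPf -> /negPf ->] := nz _ _ _ (x0mul h) x10.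
  exists (g`_3 * g`_1); rewrite (x0mul h) x10; ring.
have [x20|x20] := eqVneq x2 0.
  have h : x1 * x2 * x3 = 0 by rewrite x20 mulr0 mul0r.
  have h1 : g`_1 = g`_3 * (x2 * x1 + x2 * x3 + x1 * x3).
    by rewrite (x0mul h); ring.
  have /andP[_ /negPf ->] := nz _ _ _ h1 x20.
  exists (g`_3 * g`_1); rewrite (x0mul h) x20; ring.
have [x30|x30] := eqVneq x3 0.
  have h : x1 * x2 * x3 = 0 by rewrite x30 mulr0.
  exists (g`_3 * g`_1); rewrite (x0mul h) x30; ring.
exists (g`_3 * (y1 - l * x1)); rewrite exprMn cst; ring.
Qed.

Lemma alphaD (P Q : ec_point E) :
  sqeq (alpha (P + Q : ec_point E)) (alpha P * alpha Q).
Proof.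
case: P => [[[x1 y1]|] oP]; last first.
  by rewrite (_ : Point oP = 0) ?add0r ?mul1r; [exact: sqeq_refl|exact: val_inj].
case: Q => [[[x2 y2]|] oQ]; last first.
  by rewrite (_ : Point oQ = 0) ?addr0 ?mulr1; [exact: sqeq_refl|exact: val_inj].
rewrite [X in alpha X]/= /=.
have [/andP[/eqP ex _]|nopp] := boolP ((x1 == x2) && (y1 == - y2)).
  (* Opposite points share their abscissa, so the product of their classes is a square. *)
  rewrite -ex; apply/sqeq_sym/sqeq_sqr; exact: (alpha_neq0 (Some (x1, y1))).
have [s es] := alpha_collinear (eqP oP) (eqP oQ) nopp.
have u0 := alpha_neq0 (Some (x1, y1)); have v0 := alpha_neq0 (Some (x2, y2)).
have nx := alpha_neq0
  (Some ((ec_slope E x1 y1 x2 y2 ^+ 2 - g`_2) / g`_3 - x1 - x2, 0)).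
rewrite /= in es u0 v0 nx *.
move: es u0 v0 nx; set u := if _ then _ else _.
set v := if x2 == 0 then _ else _; set w := if _ - x1 - x2 == 0 then _ else _.
(* From [u * v * w = s^2] comes [w = u * v * (s / (u * v))^2]. *)
move=> es u0 v0 w0; exists (s / (u * v)); last first.
  by rewrite exprMn -es; field; rewrite u0 v0.
rewrite mulf_neq0 ?invr_eq0 ?mulf_neq0 //.
by rewrite -sqrf_eq0 -es !mulf_neq0.
Qed.

Lemma alpha_double (P Q : ec_point E) :
  sqeq (alpha (Q + Q + P : ec_point E)) (alpha P).
Proof.
apply: sqeq_trans (alphaD _ _) _; rewrite -[X in sqeq _ X]mul1r.
apply: sqeqM (sqeq_refl _); apply: sqeq_trans (alphaD _ _) _.
exact/sqeq_sqr/alpha_neq0.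
Qed.

End Descent.

(** * Valuations and parity *)

(** After clearing denominators, the two sides have [q]-adic valuations of different parity. As
    [logn q 0 = 0], oddness also excludes [n = 0]. *)
Lemma nat_nonsquare (n q : nat) : odd (logn q n) -> ~ sqeq (n%:R : rat) 1.
Proof.
move=> oddn [r r0]; rewrite mul1r => e.
have n0 : (0 < n)%N by case: n oddn {e}; rewrite ?logn0.
have d0 := denq_neq0 r; have m0 : numq r != 0 by rewrite numq_eq0.
have : n%:Z * denq r ^+ 2 = numq r ^+ 2.
  apply: (@intr_inj rat); rewrite rmorphM !rmorphXn /= -pmulrn e -exprMn.
  by rewrite -numqE.
move=> /(congr1 absz); rewrite abszM !abszX absz_nat => /(congr1 (logn q)).
rewrite lognM ?expn_gt0 ?absz_gt0 ?d0 // !lognX => /(congr1 odd).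
by rewrite oddD !oddM oddn.
Qed.

Lemma odd_logn_Mp (k p : nat) : prime p -> coprime k p ->
  odd (logn p (k * p)%N).
Proof.
move=> pp; rewrite coprime_sym => cop; have k0 : (0 < k)%N.
  by case: k cop pp => //; rewrite /coprime gcdn0 => /eqP ->.
by rewrite (lognM _ k0 (prime_gt0 pp)) logn_coprime // logn_prime // eqxx.
Qed.

Lemma int_halve (m : int) : exists (m' : int) (b : bool), m = m' + m' + b%:Z.
Proof.
exists (m %/ 2)%Z, (m %% 2 == 1)%Z.
by case: eqP; lia.
Qed.

(** * Descent on [Ep] *)

Section EpDescent.
Variables (p : nat) (p_prime : prime p) (p_cop : coprime 6 p).
Local Notation E := (Ep p_prime).

Let q0 : p%:R != 0 :> rat.
Proof. by rewrite pnatr_eq0 -lt0n prime_gt0. Qed.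

Let p_cop2 : coprime 2 p.
Proof. by move: p_cop; rewrite -[6%N]/(2 * 3)%N coprimeMl => /andP[]. Qed.

Let p_cop3 : coprime 3 p.
Proof. by move: p_cop; rewrite -[6%N]/(2 * 3)%N coprimeMl => /andP[]. Qed.

Lemma Ep_coef0 : (cubic E)`_0 = 0.
Proof. by rewrite /= Ep_cubicE !coefE !mulr0 addr0. Qed.

Lemma Ep_horner (x : rat) : (cubic E).[x] = 3 * x ^+ 3 + 6 * p%:R ^+ 2 * x.
Proof. by rewrite /= Ep_cubicE !hornerE. Qed.

Lemma Ep_coef1 : (cubic E)`_1 = 6 * p%:R ^+ 2.
Proof. by rewrite /= Ep_cubicE !coefE /= mulr0 add0r mulr1. Qed.

Lemma Ep_coef3 : (cubic E)`_3 = 3.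
Proof. by rewrite /= Ep_cubicE !coefE /= mulr1 mulr0 addr0. Qed.

(** [Q = - Q] forces [y = 0], and the factor [x^2 + 2 p^2] of the cubic has no rational root, which
    leaves only T. *)
Lemma Ep_two_torsion (Q : ec_point E) : Q + Q = 0 -> Q = 0 \/ sqeq (alpha E Q) 2.
Proof.
move=> /eqP; rewrite addr_eq0 => /eqP /(congr1 val).
case: Q => [[[x y]|] oQ] /=; last by left; apply: val_inj.
case=> ey; right.
have y0 : y = 0 by lra.
have /eqP := eqP oQ; rewrite y0 Ep_horner expr0n /= eq_sym.
rewrite (_ : _ + _ = x * (3 * (x ^+ 2 + 2 * p%:R ^+ 2))); last ring.
rewrite !mulf_eq0 => /or3P[->|//|].
  (* The value at T is [3 * (6 p^2) = 2 * (3 p)^2]. *)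
  rewrite Ep_coef1 Ep_coef3; exists (3 * p%:R); last ring.
  by rewrite mulf_neq0.
rewrite paddr_eq0 ?sqr_ge0 ?mulr_ge0 ?sqr_ge0 // => /andP[_].
by rewrite mulf_eq0 sqrf_eq0 (negPf q0).
Qed.

(* The squarefree representative of the class of p ^ b * (3 * p) ^ d. *)
Definition comb_class (b d : bool) : nat :=
  if b then (if d then 3 else p) else (if d then 3 * p else 1)%N.

Lemma alpha_comb (P1 P2 : ec_point E) (b d : bool) :
  sqeq (alpha E P1) p%:R -> sqeq (alpha E P2) (3 * p)%:R ->
  sqeq (alpha E (P1 *+ b + P2 *+ d : ec_point E)) (comb_class b d)%:R.
Proof.
move=> h1 h2; rewrite !mulrb /comb_class.
case: b d => [] []; rewrite ?add0r ?addr0 //; last exact: sqeq_refl.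
apply: sqeq_trans (alphaD Ep_coef0 _ _) _; apply: sqeq_trans (sqeqM h1 h2) _.
by exists p%:R; rewrite // natrM; ring.
Qed.

(** The class 3 has odd valuation at 3, the classes [p] and [3 * p] at [p]. *)
Lemma comb_class_neq1 b d : sqeq (comb_class b d)%:R (1 : rat) -> ~~ b && ~~ d.
Proof.
case: b d => [] [] //= /(nat_nonsquare _) h; exfalso; move: h.
- by move/(_ 3%N); apply.
- by move/(_ p); apply; rewrite -[p in X in logn _ X]mul1n odd_logn_Mp ?coprime1n.
- by move/(_ p); apply; rewrite odd_logn_Mp.
Qed.

(** All four representatives are odd, so their doubles have 2-adic valuation 1. *)
Lemma comb_class_neq2 b d : ~ sqeq (2 * (comb_class b d)%:R) (1 : rat).
Proof.
rewrite -natrM; apply: (@nat_nonsquare _ 2).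
rewrite mulnC odd_logn_Mp // coprimen2 -coprime2n.
by case: b d => [] [] //=; rewrite coprimeMr.
Qed.

Lemma alpha_mulz (P1 P2 : ec_point E) (m n : int) (b d : bool) :
  sqeq (alpha E P1) p%:R -> sqeq (alpha E P2) (3 * p)%:R ->
  sqeq (alpha E (P1 *~ (m + m + b%:Z) + P2 *~ (n + n + d%:Z) : ec_point E))
    (comb_class b d)%:R.
Proof.
move=> h1 h2; rewrite !mulrzDr -!pmulrn addrACA [X in X + _]addrACA.
exact: sqeq_trans (alpha_double Ep_coef0 _ _) (alpha_comb b d h1 h2).
Qed.

Lemma independent_of_class (P1 P2 : ec_point E) :
  sqeq (alpha E P1) p%:R -> sqeq (alpha E P2) (3 * p)%:R ->
  forall m n : int, P1 *~ m + P2 *~ n = 0 -> m = 0 /\ n = 0.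
Proof.
move=> h1 h2 m n; have [k] := ubnP (`|m| + `|n|)%N.
elim: k m n => // k IH m n le e.
have [/andP[/eqP -> /eqP -> //]|mn0] := boolP ((m == 0) && (n == 0)).
have [m' [b em]] := int_halve m; have [n' [d en]] := int_halve n.
have := alpha_mulz m' n' b d h1 h2; rewrite -em -en e.
move=> /sqeq_sym/comb_class_neq1/andP[/negPf b0 /negPf d0].
rewrite b0 addr0 in em; rewrite d0 addr0 in en.
have /Ep_two_torsion[e0|c2] : (P1 *~ m' + P2 *~ n') + (P1 *~ m' + P2 *~ n') = 0.
- by rewrite -e em en !mulrzDr addrACA.
- have [|m0 n0] := IH m' n' _ e0; last by rewrite em en m0 n0.
  (* The measure is halved, and it was nonzero by [mn0]. *)
  by lia.
(* Otherwise the half-relation has class 2, yet as a combination of [P1] and [P2] it also has one of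
   the four classes [comb_class]. *)
have [m2 [b' em']] := int_halve m'; have [n2 [d' en']] := int_halve n'.
have := alpha_mulz m2 n2 b' d' h1 h2; rewrite -em' -en' => c.
case: (@comb_class_neq2 b' d'); apply: sqeq_mul1.
  rewrite pnatr_eq0 -lt0n /comb_class; do 2?[case: ifP => _] => //;
  by rewrite ?muln_gt0 (prime_gt0 p_prime).
exact: sqeq_trans (sqeq_sym c2) c.
Qed.

(** The equation is the 2-covering attached to [k]: it puts [(k t^2, k t w)] on
    [y^2 = x^3 + 18 p^2 x], and division by 3 returns to [Ep]. *)
Lemma Ep_point_of_quartic (k t w : rat) : k != 0 -> t != 0 ->
  k * w ^+ 2 = k ^+ 2 * t ^+ 4 + 18 * p%:R ^+ 2 ->
  exists P : ec_point E, sqeq (alpha E P) k.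
Proof.
move=> k0 t0 e.
have oP : on_curve E (Some (k * t ^+ 2 / 3, k * t * w / 3)).
  rewrite /on_curve Ep_horner; apply/eqP.
  have -> : (k * t * w / 3) ^+ 2 = k * t ^+ 2 / 9 * (k * w ^+ 2) by field.
  by rewrite e; field.
exists (Point oP); exists t => //=.
rewrite ifF; last by apply/negbTE; rewrite !mulf_neq0 ?expf_neq0.
by have := Ep_coef3; rewrite /= => ->; field.
Qed.

End EpDescent.

(** * Points from the two representations, and the rank bound *)

Unset Implicit Arguments.
Set Strict Implicit.

Theorem proposition0p3 (p : nat) (p_prime : prime p)
    (p_mod24 : p = 1 %[mod 24]) (p_quartic : quartic_symbol 2 p = 1)
    (p_repr : exists a b c d : int,
        p%:Z = a ^+ 4 + 18 * b ^+ 4 /\ 3 * p%:Z = c ^+ 4 + 2 * d ^+ 4) :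
  (2%:E <= zrank (ec_point (Ep p_prime)))%E.
Proof.
have p_cop : coprime 6 p.
  have : coprime 24 p by rewrite -coprime_modr p_mod24.
  by rewrite -[24%N]/(6 * 4)%N coprimeMl => /andP[].
have /andP[p_cop2 p_cop3] : coprime 2 p && coprime 3 p.
  by rewrite -coprimeMl.
have q0 : (p%:R : rat) != 0 by rewrite pnatr_eq0 -lt0n prime_gt0.
have p3 : (3 * p)%N != 0%N by rewrite -lt0n muln_gt0 (prime_gt0 p_prime).
case: p_repr => a [b [c [d [/(congr1 (fun z : int => z%:~R : rat)) e1
  /(congr1 (fun z : int => z%:~R : rat)) e2]]]].
move: e1 e2; rewrite !(rmorphD, rmorphM, rmorphXn) /= -pmulrn.
move: (a%:~R) (b%:~R) (c%:~R) (d%:~R) => {a b c d} a b c d e1 e2.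
have nonsq (k : nat) (u : rat) : coprime k p -> (k * p)%:R = u ^+ 2 -> False.
  move=> kp e; have /nat_nonsquare := odd_logn_Mp p_prime kp; apply.
  exists u; last by rewrite mul1r.
  rewrite -sqrf_eq0 -e pnatr_eq0 -lt0n muln_gt0 (prime_gt0 p_prime) andbT lt0n.
  by apply: contraTneq kp => ->; rewrite /coprime gcd0n neq_ltn prime_gt1 ?orbT.
(* A zero value of [b], [a], [d] or [c] would make [p], [2p], [3p] or [6p] a square,
   respectively. *)
have b0 : b != 0.
  apply/eqP => b0; apply: (nonsq 1%N (a ^+ 2)); rewrite ?coprime1n //.
  by rewrite natrM e1 b0; ring.
have a0 : a != 0.
  apply/eqP => a0; apply: (nonsq 2%N (6 * b ^+ 2)) => //; rewrite natrM e1 a0; ring.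
have d0 : d != 0.
  by apply/eqP => d0; apply: (nonsq 3%N (c ^+ 2)) => //; rewrite natrM e2 d0; ring.
have c0 : c != 0.
  apply/eqP => c0; apply: (nonsq 6%N (2 * d ^+ 2)) => //.
  by rewrite -[6%N]/(2 * 3)%N -mulnA natrM [(3 * p)%:R]natrM e2 c0; ring.
(* The quartic for [k = p] is [p = a^4 + 18 b^4] multiplied by [p^2 / b^4]. *)
have [|||P1 h1] := @Ep_point_of_quartic p p_prime p%:R (a / b) (p%:R / b ^+ 2).
- by [].
- by rewrite mulf_neq0 ?invr_eq0.
- have -> : p%:R ^+ 2 * (a / b) ^+ 4 + 18 * p%:R ^+ 2
    = p%:R ^+ 2 / b ^+ 4 * (a ^+ 4 + 18 * b ^+ 4) :> rat by field.
  by rewrite -e1; field.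
(* The quartic for [k = 3p] is [3p = c^4 + 2 d^4] multiplied by [(3p)^2 / d^4], as
   [2 * 3^2 = 18]. *)
have [|||P2 h2] :=
  @Ep_point_of_quartic p p_prime (3 * p)%:R (c / d) ((3 * p)%:R / d ^+ 2).
- by rewrite pnatr_eq0.
- by rewrite mulf_neq0 ?invr_eq0.
- rewrite natrM; have -> : (3 * p%:R) ^+ 2 * (c / d) ^+ 4 + 18 * p%:R ^+ 2
    = (3 * p%:R) ^+ 2 / d ^+ 4 * (c ^+ 4 + 2 * d ^+ 4) :> rat by field.
  by rewrite -e2; field.
apply/(zrank_geP _ 2); exists (fun i : 'I_2 => if i == 0 then P1 else P2) => m.
rewrite big_ord_recl big_ord1 /= => e.
have [m0 m1] := independent_of_class p_cop h1 h2 e.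
by case=> [[|[|//]] hi]; [rewrite -m0|rewrite -m1]; congr (m _); apply: val_inj.
Qed.
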